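(* Suppose that $E$ is an equivalence relation on $\omega$ which is complete under $\leq_c^4$ among $\Pi^0_2$ equivalence relations, and let $h$ be any computable $\Pi^0_2$-approximating function for $E$. Then $E$ has infinitely many equivalence classes which are not $\Delta^0_2$ under $h$.
   Context: For equivalence relations $F,E$ on $\omega$, $F\leq_c^4E$ means there is a total computable function mapping each $(x_0,\dots,x_3)\in\omega^4$ to $(y_0,\dots,y_3)\in\omega^4$ with $x_i\,F\,x_j\iff y_i\,E\,y_j$ for all $i<j<4$; $E$ is complete under $\leq_c^4$ among $\Pi^0_2$ equivalence relations if $E$ is a $\Pi^0_2$ subset of $\omega\times\omega$ and $F\leq_c^4E$ for every $\Pi^0_2$ equivalence relation $F$ on $\omega$. A computable $\Pi^0_2$-approximating function for $E$ is a total computable $h:\omega^3\to\omega$ such that for all $x,y$: $x\,E\,y\iff h(x,y,s)=1$ for infinitely many $s$. Under such $h$, an $E$-class $[z]_E$ is $\Delta^0_2$ if for all $x,y\in[z]_E$, $\lim_sh(x,y,s)=1$ (i.e. $h(x,y,s)=1$ for all sufficiently large $s$). *)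

(* Defs.v *)
From Stdlib Require Import List Arith.
Import ListNotations.

Inductive code : Type :=
| CZero : code
| CSucc : code
| CProj : nat -> code
| CComp : code -> list code -> code
| CPrec : code -> code -> code
| CMu   : code -> code.

Inductive eval : code -> list nat -> nat -> Prop :=
| ev_zero : forall args, eval CZero args 0
| ev_succ : forall x args, eval CSucc (x :: args) (S x)
| ev_proj : forall i args, i < length args -> eval (CProj i) args (nth i args 0)
| ev_comp : forall f gs args vs v,
    evals gs args vs -> eval f vs v -> eval (CComp f gs) args v
| ev_prec0 : forall f g rest v,
    eval f rest v -> eval (CPrec f g) (0 :: rest) v
| ev_precS : forall f g n rest w v,
    eval (CPrec f g) (n :: rest) w -> eval g (n :: w :: rest) v ->
    eval (CPrec f g) (S n :: rest) v
| ev_mu : forall f args n,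
    eval f (n :: args) 0 ->
    (forall m, m < n -> exists k, eval f (m :: args) (S k)) ->
    eval (CMu f) args n
with evals : list code -> list nat -> list nat -> Prop :=
| evs_nil : forall args, evals [] args []
| evs_cons : forall g gs args v vs,
    eval g args v -> evals gs args vs -> evals (g :: gs) args (v :: vs).

Definition computable2 (f : nat -> nat -> nat) : Prop :=
  exists c, forall x y, eval c [x; y] (f x y).
Definition computable3 (f : nat -> nat -> nat -> nat) : Prop :=
  exists c, forall x y z, eval c [x; y; z] (f x y z).
Definition computable4 (f : nat -> nat -> nat -> nat -> nat) : Prop :=
  exists c, forall x y z w, eval c [x; y; z; w] (f x y z w).

Definition is_equivalence (E : nat -> nat -> Prop) : Prop :=
  (forall x, E x x) /\ (forall x y, E x y -> E y x) /\
  (forall x y z, E x y -> E y z -> E x z).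

Definition Pi02 (E : nat -> nat -> Prop) : Prop :=
  exists r : nat -> nat -> nat -> nat -> nat, computable4 r /\
    forall x y, E x y <-> (forall n, exists m, r x y n m = 1).

(* F <=_c^4 E : a total computable map omega^4 -> omega^4, given by its four
   (total computable) components g0..g3, preserving and reflecting the
   relations between all pairs i<j. *)
Definition tuple4 (g0 g1 g2 g3 : nat -> nat -> nat -> nat -> nat)
  (x0 x1 x2 x3 : nat) (i : nat) : nat :=
  match i with
  | 0 => g0 x0 x1 x2 x3
  | 1 => g1 x0 x1 x2 x3
  | 2 => g2 x0 x1 x2 x3
  | _ => g3 x0 x1 x2 x3
  end.

Definition sel4 (x0 x1 x2 x3 : nat) (i : nat) : nat :=
  match i with 0 => x0 | 1 => x1 | 2 => x2 | _ => x3 end.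

Definition reduces4 (F E : nat -> nat -> Prop) : Prop :=
  exists g0 g1 g2 g3 : nat -> nat -> nat -> nat -> nat,
    computable4 g0 /\ computable4 g1 /\ computable4 g2 /\ computable4 g3 /\
    forall x0 x1 x2 x3 i j, i < j -> j < 4 ->
      (F (sel4 x0 x1 x2 x3 i) (sel4 x0 x1 x2 x3 j) <->
       E (tuple4 g0 g1 g2 g3 x0 x1 x2 x3 i) (tuple4 g0 g1 g2 g3 x0 x1 x2 x3 j)).

Definition complete4_Pi02 (E : nat -> nat -> Prop) : Prop :=
  Pi02 E /\ forall F, is_equivalence F -> Pi02 F -> reduces4 F E.

Definition Pi02_approx (E : nat -> nat -> Prop) (h : nat -> nat -> nat -> nat) : Prop :=
  computable3 h /\
  forall x y, E x y <-> (forall s0, exists s, s0 <= s /\ h x y s = 1).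

Definition class_Delta02 (E : nat -> nat -> Prop) (h : nat -> nat -> nat -> nat) (z : nat) : Prop :=
  forall x y, E x z -> E y z -> exists s0, forall s, s0 <= s -> h x y s = 1.

(* Main.v *)
(** Suppose that all classes that are not Delta02 under [h] meet the finite list
[l]. We diagonalise with an equivalence relation [F] on points [<e,i>], where [e]
codes four programs, [y0], .., [y3] are their outputs on [<e,0>], .., [<e,3>], and
points with different [e] are unrelated. Put [<e,0> F <e,1>] iff
[h y0 y1 s <> 1] for infinitely many [s], put [<e,2> F <e,3>] iff
[h y2 y3 s <> 1] for infinitely many [s], and merge the two pairs iff both
conditions hold and [y0 E w], [y2 E w'] for some [E]-inequivalent [w], [w'] in [l].
If [e] were a reduction of [F] to [E], then [y0 E y1], as otherwise
[h y0 y1 s <> 1] for almost all [s]; hence [h y0 y1 s <> 1] infinitely often, so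
the class of [y0] is not Delta02 and meets [l]. The same holds for [y2]. But then
the two pairs are merged in [F] exactly when [y0] and [y2] are not [E]-equivalent. *)

Require Import Defs.
From Stdlib Require Import List Arith Lia Classical.
Import ListNotations.

(** * Computability in a list of variables: composition and primitive recursion *)

Definition computable1 (f : nat -> nat) : Prop :=
  exists c, forall x, eval c [x] (f x).

(** Packing the variables into one list lets the closure properties be proved once for every number
    [n] of variables; the [i]-th variable is the term [nth i l 0]. *)
Definition computable_list (n : nat) (f : list nat -> nat) : Prop :=
  exists c, forall l, length l = n -> eval c l (f l).

Lemma computable_list_ext n f g :
  computable_list n f -> (forall l, length l = n -> f l = g l) ->
  computable_list n g.
Proof.
  intros [c Hc] Hfg. exists c. intros l Hl. rewrite <- Hfg by exact Hl. auto.
Qed.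

Lemma computable_list_var n i : i < n -> computable_list n (fun l => nth i l 0).
Proof. intros Hi. exists (CProj i). intros l Hl. constructor. lia. Qed.

Lemma computable_list_const n k : computable_list n (fun _ => k).
Proof.
  induction k as [|k [c Hc]].
  - exists CZero. constructor.
  - exists (CComp CSucc [c]). intros l Hl.
    econstructor; [repeat constructor; auto | constructor].
Qed.

Lemma computable_list_app1 n f a :
  computable1 f -> computable_list n a -> computable_list n (fun l => f (a l)).
Proof.
  intros [c Hc] [ca Ha]. exists (CComp c [ca]). intros l Hl.
  econstructor; [repeat constructor; auto | apply Hc].
Qed.

Lemma computable_list_app2 n f a b :
  computable2 f -> computable_list n a -> computable_list n b ->
  computable_list n (fun l => f (a l) (b l)).
Proof.
  intros [c Hc] [ca Ha] [cb Hb]. exists (CComp c [ca; cb]). intros l Hl.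
  econstructor; [repeat constructor; auto | apply Hc].
Qed.

Lemma computable_list_app3 n f a b d :
  computable3 f -> computable_list n a -> computable_list n b ->
  computable_list n d -> computable_list n (fun l => f (a l) (b l) (d l)).
Proof.
  intros [c Hc] [ca Ha] [cb Hb] [cd Hd]. exists (CComp c [ca; cb; cd]).
  intros l Hl. econstructor; [repeat constructor; auto | apply Hc].
Qed.

Lemma computable_list_app4 n f a b d e :
  computable4 f -> computable_list n a -> computable_list n b ->
  computable_list n d -> computable_list n e ->
  computable_list n (fun l => f (a l) (b l) (d l) (e l)).
Proof.
  intros [c Hc] [ca Ha] [cb Hb] [cd Hd] [ce He].
  exists (CComp c [ca; cb; cd; ce]).
  intros l Hl. econstructor; [repeat constructor; auto | apply Hc].
Qed.

(** With [m = 0] these projections pass all parameters unchanged to a primitive recursion. *)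
Lemma evals_proj l m k :
  m + k = length l -> evals (map CProj (seq m k)) l (skipn m l).
Proof.
  revert m; induction k as [|k IH]; intros m H.
  - rewrite skipn_all2 by lia. constructor.
  - assert (E : skipn m l = nth m l 0 :: skipn (S m) l).
    { clear IH. assert (Hm : m < length l) by lia. clear H k.
      revert m Hm; induction l as [|x l IH]; intros [|m] Hm; simpl in *;
        [lia | lia | reflexivity | apply IH; lia]. }
    rewrite E. simpl. constructor; [constructor; lia | apply IH; lia].
Qed.

(** The step sees the counter and the previous value in front of [l], as in [ev_precS], so variable
    [i] of [l] is variable [i + 2] inside [s]. *)
Lemma computable_list_rec n b s t :
  computable_list n b -> computable_list (S (S n)) s -> computable_list n t ->
  computable_list n
    (fun l => nat_rect (fun _ => nat) (b l) (fun k w => s (k :: w :: l)) (t l)).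
Proof.
  intros [cb Hb] [cs Hs] [ct Ht].
  exists (CComp (CPrec cb cs) (ct :: map CProj (seq 0 n))). intros l Hl.
  econstructor.
  - constructor; [apply Ht, Hl | apply evals_proj; simpl; lia].
  - simpl. induction (t l) as [|k IH]; simpl.
    + constructor. auto.
    + econstructor; [exact IH|]. apply Hs. simpl. lia.
Qed.

Lemma computable1_of_list f :
  computable_list 1 (fun l => f (nth 0 l 0)) -> computable1 f.
Proof. intros [c Hc]. exists c. intros x. exact (Hc [x] eq_refl). Qed.

Lemma computable2_of_list f :
  computable_list 2 (fun l => f (nth 0 l 0) (nth 1 l 0)) -> computable2 f.
Proof. intros [c Hc]. exists c. intros x y. exact (Hc [x; y] eq_refl). Qed.

Lemma computable3_of_list f :
  computable_list 3 (fun l => f (nth 0 l 0) (nth 1 l 0) (nth 2 l 0)) ->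
  computable3 f.
Proof. intros [c Hc]. exists c. intros x y z. exact (Hc [x; y; z] eq_refl). Qed.

Lemma computable4_of_list f :
  computable_list 4
    (fun l => f (nth 0 l 0) (nth 1 l 0) (nth 2 l 0) (nth 3 l 0)) ->
  computable4 f.
Proof.
  intros [c Hc]. exists c. intros x y z w. exact (Hc [x; y; z; w] eq_refl).
Qed.

(* Automated computability proofs and basic arithmetic *)
Create HintDb computable.

(** Larger arities come first, so that a function with constant leading arguments is not taken for a
    partial application. *)
Ltac computable_step :=
  match goal with
  | |- computable_list _ (fun _ => ?k) => apply computable_list_const
  | |- computable_list _ (fun l => nth ?i l 0) => apply computable_list_var; lia
  | |- computable_list ?n (fun l => ?f (@?a l) (@?b l) (@?d l) (@?e l)) =>
      apply (computable_list_app4 n f a b d e); [solve [auto with computable]|..]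
  | |- computable_list ?n (fun l => ?f (@?a l) (@?b l) (@?d l)) =>
      apply (computable_list_app3 n f a b d); [solve [auto with computable]|..]
  | |- computable_list ?n (fun l => ?f (@?a l) (@?b l)) =>
      apply (computable_list_app2 n f a b); [solve [auto with computable]|..]
  | |- computable_list ?n (fun l => ?f (@?a l)) =>
      apply (computable_list_app1 n f a); [solve [auto with computable]|..]
  end.

Ltac computable_auto := repeat computable_step.

Ltac computable_unfold f :=
  first [ apply computable1_of_list | apply computable2_of_list
        | apply computable3_of_list | apply computable4_of_list ];
  unfold f; computable_auto.

Lemma computable_succ : computable1 S.
Proof. exists CSucc. constructor. Qed.
#[local] Hint Resolve computable_succ : computable.

Lemma computable_pred : computable1 Nat.pred.
Proof.
  apply computable1_of_list. eapply computable_list_ext.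
  - apply (computable_list_rec 1 (fun _ => 0) (fun l => nth 0 l 0)
             (fun l => nth 0 l 0)); computable_auto.
  - intros l _; simpl. now destruct (nth 0 l 0).
Qed.
#[local] Hint Resolve computable_pred : computable.

Lemma computable_add : computable2 Nat.add.
Proof.
  apply computable2_of_list. eapply computable_list_ext.
  - apply (computable_list_rec 2 (fun l => nth 1 l 0) (fun l => S (nth 1 l 0))
             (fun l => nth 0 l 0)); computable_auto.
  - intros l _; simpl. induction (nth 0 l 0); simpl; congruence.
Qed.
#[local] Hint Resolve computable_add : computable.

Lemma computable_sub : computable2 Nat.sub.
Proof.
  apply computable2_of_list. eapply computable_list_ext.
  - apply (computable_list_rec 2 (fun l => nth 0 l 0)
             (fun l => Nat.pred (nth 1 l 0)) (fun l => nth 1 l 0));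
      computable_auto.
  - intros l _; simpl. induction (nth 1 l 0); simpl; lia.
Qed.
#[local] Hint Resolve computable_sub : computable.

Definition ifz (a b c : nat) : nat := match a with 0 => b | S _ => c end.

Lemma computable_ifz : computable3 ifz.
Proof.
  apply computable3_of_list. eapply computable_list_ext.
  - apply (computable_list_rec 3 (fun l => nth 1 l 0) (fun l => nth 4 l 0)
             (fun l => nth 0 l 0)); computable_auto.
  - intros l _; simpl. now destruct (nth 0 l 0).
Qed.
#[local] Hint Resolve computable_ifz : computable.

Lemma computable_iter f : computable1 f -> computable2 (fun t s => Nat.iter t f s).
Proof.
  intros Hf. apply computable2_of_list. eapply computable_list_ext.
  - apply (computable_list_rec 2 (fun l => nth 1 l 0) (fun l => f (nth 1 l 0))
             (fun l => nth 0 l 0)); computable_auto.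
  - intros l _; simpl. induction (nth 0 l 0); simpl; congruence.
Qed.

(** * Cantor pairing *)

Fixpoint tri (n : nat) : nat := match n with 0 => 0 | S n => S n + tri n end.

Definition cpair (x y : nat) : nat := tri (x + y) + y.

(** The index of the antidiagonal containing [n], that is, the largest [d] with [tri d <= n]. It
    grows exactly when [S n] reaches the next triangular number, which the truncated subtraction
    detects. *)
Fixpoint diag (n : nat) : nat :=
  match n with
  | 0 => 0
  | S n => ifz (tri (S (diag n)) - S n) (S (diag n)) (diag n)
  end.

Definition csnd (n : nat) : nat := n - tri (diag n).
Definition cfst (n : nat) : nat := diag n - csnd n.

Lemma diag_spec n : tri (diag n) <= n < tri (S (diag n)).
Proof.
  induction n as [|n IH]; [simpl; lia|].
  cbn [diag]. destruct (tri (S (diag n)) - S n) eqn:E; cbn [ifz tri] in *; lia.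
Qed.

Lemma tri_mono a b : a <= b -> tri a <= tri b.
Proof. induction 1; simpl; lia. Qed.

Lemma diag_cpair x y : diag (cpair x y) = x + y.
Proof.
  pose proof (diag_spec (cpair x y)) as H. unfold cpair in *.
  set (d := diag _) in *.
  destruct (lt_eq_lt_dec d (x + y)) as [[L|L]|L]; [|exact L|].
  - pose proof (tri_mono (S d) (x + y)). lia.
  - pose proof (tri_mono (S (x + y)) d). cbn [tri] in *. lia.
Qed.

Lemma csnd_cpair x y : csnd (cpair x y) = y.
Proof. unfold csnd. rewrite diag_cpair. unfold cpair. lia. Qed.

Lemma cfst_cpair x y : cfst (cpair x y) = x.
Proof. unfold cfst. rewrite diag_cpair, csnd_cpair. lia. Qed.

Lemma computable_tri : computable1 tri.
Proof.
  apply computable1_of_list. eapply computable_list_ext.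
  - apply (computable_list_rec 1 (fun _ => 0)
             (fun l => S (nth 0 l 0) + nth 1 l 0)
             (fun l => nth 0 l 0)); computable_auto.
  - intros l _; simpl. induction (nth 0 l 0); simpl in *; congruence.
Qed.
#[local] Hint Resolve computable_tri : computable.

Lemma computable_diag : computable1 diag.
Proof.
  apply computable1_of_list. eapply computable_list_ext.
  - apply (computable_list_rec 1 (fun _ => 0)
             (fun l => ifz (tri (S (nth 1 l 0)) - S (nth 0 l 0))
                           (S (nth 1 l 0)) (nth 1 l 0))
             (fun l => nth 0 l 0)); computable_auto.
  - intros l _; cbv beta. generalize (nth 0 l 0). intros k.
    induction k as [|k IH]; [reflexivity|]. cbn [nat_rect diag].
    rewrite IH. reflexivity.
Qed.
#[local] Hint Resolve computable_diag : computable.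

Lemma computable_cpair : computable2 cpair.
Proof. computable_unfold cpair. Qed.
Lemma computable_csnd : computable1 csnd.
Proof. computable_unfold csnd. Qed.
#[local] Hint Resolve computable_cpair computable_csnd : computable.
Lemma computable_cfst : computable1 cfst.
Proof. computable_unfold cfst. Qed.
#[local] Hint Resolve computable_cfst : computable.

(** The successor keeps [0] free to code the empty list. *)
Definition ccons (x l : nat) : nat := S (cpair x l).
Definition chd (l : nat) : nat := cfst (Nat.pred l).
Definition ctl (l : nat) : nat := csnd (Nat.pred l).

Lemma chd_ccons x l : chd (ccons x l) = x.
Proof. apply cfst_cpair. Qed.
Lemma ctl_ccons x l : ctl (ccons x l) = l.
Proof. apply csnd_cpair. Qed.

Lemma computable_ccons : computable2 ccons.
Proof. computable_unfold ccons. Qed.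
Lemma computable_chd : computable1 chd.
Proof. computable_unfold chd. Qed.
Lemma computable_ctl : computable1 ctl.
Proof. computable_unfold ctl. Qed.
#[local] Hint Resolve computable_ccons computable_chd computable_ctl : computable.

(** * A computable interpreter *)

Definition encl (l : list nat) : nat := fold_right ccons 0 l.

(** The first component is the tag on which [dispatch] branches. *)
Fixpoint enc (c : code) : nat :=
  match c with
  | CZero => cpair 0 0
  | CSucc => cpair 1 0
  | CProj i => cpair 2 i
  | CComp f gs => cpair 3 (cpair (enc f) (encl (map enc gs)))
  | CPrec f g => cpair 4 (cpair (enc f) (enc g))
  | CMu f => cpair 5 (enc f)
  end.

Definition push (tag p a k : nat) : nat := ccons (cpair (cpair tag p) a) k.

(* A task is [<<tag, p>, a>]; a state [<k, d>] consists of a stack [k] of tasks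
   and a stack [d] of values. Tags 0 to 5 evaluate the code [<tag, p>] on the
   argument list [a]. Auxiliary tags: 6 evaluates the list of codes [p] on [a];
   7 conses the two topmost values; 8 applies the code [p] to the topmost value;
   9 applies the step code [p] of a recursion at [a = n :: rest] to the topmost
   value; 10 tests the topmost value in an unbounded search that has reached the
   head of [a]. *)
Definition dispatch (tag p a k d : nat) : nat :=
  ifz tag (cpair k (ccons 0 d))
  (ifz (tag - 1) (cpair k (ccons (S (chd a)) d))
  (ifz (tag - 2)
     (ifz p (cpair k (ccons (chd a) d))
            (cpair (push 2 (Nat.pred p) (ctl a) k) d))
  (ifz (tag - 3) (cpair (push 6 (csnd p) a (push 8 (cfst p) 0 k)) d)
  (ifz (tag - 4)
     (ifz (chd a) (cpair (ccons (cpair (cfst p) (ctl a)) k) d)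
        (cpair (push 4 p (ccons (Nat.pred (chd a)) (ctl a))
                 (push 9 (csnd p) (ccons (Nat.pred (chd a)) (ctl a)) k)) d))
  (ifz (tag - 5)
     (cpair (ccons (cpair p (ccons 0 a)) (push 10 p (ccons 0 a) k)) d)
  (ifz (tag - 6)
     (ifz p (cpair k (ccons 0 d))
        (cpair (push 6 (ctl p) a (ccons (cpair (chd p) a) (push 7 0 0 k))) d))
  (ifz (tag - 7)
     (cpair k (ccons (ccons (chd d) (chd (ctl d))) (ctl (ctl d))))
  (ifz (tag - 8) (cpair (ccons (cpair p (chd d)) k) (ctl d))
  (ifz (tag - 9)
     (cpair (ccons (cpair p (ccons (chd a) (ccons (chd d) (ctl a)))) k) (ctl d))
  (ifz (chd d) (cpair k (ccons (chd a) (ctl d)))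
     (cpair (ccons (cpair p (ccons (S (chd a)) (ctl a)))
              (push 10 p (ccons (S (chd a)) (ctl a)) k)) (ctl d)))))))))))).

Definition step_task (t k d : nat) : nat :=
  dispatch (cfst (cfst t)) (csnd (cfst t)) (csnd t) k d.

Definition step (s : nat) : nat :=
  ifz (cfst s) s (step_task (chd (cfst s)) (ctl (cfst s)) (csnd s)).

Lemma computable_push : computable4 push.
Proof. computable_unfold push. Qed.
#[local] Hint Resolve computable_push : computable.

Lemma computable_step_task : computable3 step_task.
Proof. unfold step_task. computable_unfold dispatch. Qed.
#[local] Hint Resolve computable_step_task : computable.

Lemma computable_step : computable1 step.
Proof. computable_unfold step. Qed.
#[local] Hint Resolve computable_step : computable.

Definition steps (s s' : nat) : Prop := exists t, Nat.iter t step s = s'.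

Lemma steps_trans s1 s2 s3 : steps s1 s2 -> steps s2 s3 -> steps s1 s3.
Proof.
  intros [t1 H1] [t2 H2]. exists (t2 + t1). rewrite Nat.iter_add. congruence.
Qed.

Lemma steps_push tag p a k d s :
  steps (dispatch tag p a k d) s -> steps (cpair (push tag p a k) d) s.
Proof.
  apply steps_trans. exists 1. simpl. unfold step at 1, push, step_task.
  rewrite cfst_cpair, csnd_cpair, chd_ccons, ctl_ccons, !cfst_cpair, !csnd_cpair.
  reflexivity.
Qed.

Ltac machine_step :=
  apply steps_push; unfold dispatch;
  rewrite ?chd_ccons, ?ctl_ccons; cbn [ifz Nat.sub Nat.pred];
  rewrite ?chd_ccons, ?ctl_ccons, ?cfst_cpair, ?csnd_cpair.

(** Arbitrary remaining stacks [k] and [d] let runs of subprograms be chained by transitivity.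
    Recursion on the derivation reaches both the mutual premises and the subderivations under the
    existential of [ev_mu]. *)
Fixpoint eval_steps c args v (H : eval c args v) {struct H} :
  forall k d, steps (cpair (ccons (cpair (enc c) (encl args)) k) d)
                    (cpair k (ccons v d))
with evals_steps gs args vs (H : evals gs args vs) {struct H} :
  forall k d, steps (cpair (push 6 (encl (map enc gs)) (encl args) k) d)
                    (cpair k (ccons (encl vs) d)).
Proof.
  - destruct H as [args|x args|i args Hi|f gs args vs v Hgs Hf|f g rest v Hf
                  |f g n rest w v Hn Hg|f args n Hn Hlt]; intros k d;
      cbn [enc encl fold_right].
    + machine_step. exists 0; reflexivity.
    + machine_step. exists 0; reflexivity.
    (* The machine finds the [i]-th argument by dropping one list entry per step. *)
    + revert args Hi. induction i as [|i IH]; intros [|x args] Hi;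
        simpl in Hi; try lia; cbn [encl fold_right nth]; machine_step.
      * exists 0; reflexivity.
      * apply IH. lia.
    + machine_step. eapply steps_trans; [apply (evals_steps _ _ _ Hgs)|].
      machine_step. apply (eval_steps _ _ _ Hf).
    + machine_step. apply (eval_steps _ _ _ Hf).
    + machine_step. eapply steps_trans; [apply (eval_steps _ _ _ Hn)|].
      machine_step. apply (eval_steps _ _ _ Hg).
    + machine_step.
      (* Invariant of the unbounded search: it is about to test candidate [m], at distance [j] from
         the least zero [n]. *)
      assert (Hloop : forall j m, m + j = n ->
        steps (cpair (ccons (cpair (enc f) (ccons m (encl args)))
                       (push 10 (enc f) (ccons m (encl args)) k)) d)
              (cpair k (ccons n d))).
      { induction j as [|j IH]; intros m Hm.
        - replace m with n by lia.
          eapply steps_trans; [apply (eval_steps _ _ _ Hn)|].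
          machine_step. exists 0; reflexivity.
        - assert (Hmn : m < n) by lia.
          destruct (Hlt m Hmn) as [q Hq].
          eapply steps_trans; [apply (eval_steps _ _ _ Hq)|].
          machine_step. apply IH. lia. }
      apply (Hloop n 0). reflexivity.
  - destruct H as [args|g gs args v vs Hg Hgs]; intros k d;
      cbn [map encl fold_right].
    + machine_step. exists 0; reflexivity.
    + machine_step.
      (* The tail is evaluated before the head, so the head value lies on top when tag 7 conses. *)
      eapply steps_trans; [apply (evals_steps _ _ _ Hgs)|].
      eapply steps_trans; [apply (eval_steps _ _ _ Hg)|].
      machine_step. exists 0; reflexivity.
Qed.

Definition step_iter (t s : nat) : nat := Nat.iter t step s.

Lemma computable_step_iter : computable2 step_iter.
Proof. exact (computable_iter _ computable_step). Qed.
#[local] Hint Resolve computable_step_iter : computable.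

Definition run (c a t : nat) : nat :=
  chd (csnd (step_iter t (cpair (ccons (cpair c a) 0) 0))).

Lemma computable_run : computable3 run.
Proof. computable_unfold run. Qed.
#[local] Hint Resolve computable_run : computable.

(** Once the task stack is empty, [step] fixes the state, so the output is the limit of the stage
    values. *)
Lemma run_eval c args v :
  eval c args v -> exists T, forall t, T <= t -> run (enc c) (encl args) t = v.
Proof.
  intros H. destruct (eval_steps _ _ _ H 0 0) as [T HT]. exists T.
  intros t Ht. unfold run, step_iter. replace t with ((t - T) + T) by lia.
  rewrite Nat.iter_add, HT.
  replace (Nat.iter (t - T) step (cpair 0 (ccons v 0))) with (cpair 0 (ccons v 0)).
  - rewrite csnd_cpair. apply chd_ccons.
  - induction (t - T) as [|n IH]; [reflexivity|]. rewrite Nat.iter_succ, <- IH.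
    unfold step. rewrite cfst_cpair. reflexivity.
Qed.

(** * Closure properties of Pi02 relations *)

Definition infinitely_often (P : nat -> Prop) : Prop :=
  forall n, exists m, n <= m /\ P m.

(** This will replace stage values of programs by their final outputs. *)
Lemma infinitely_often_eventually (P Q : nat -> Prop) T :
  (forall t, T <= t -> (P t <-> Q t)) -> infinitely_often P <-> infinitely_often Q.
Proof.
  intros H; split; intros HP n; destruct (HP (n + T)) as [m [Hm Pm]];
    exists m; (split; [lia|]); apply H; (lia || assumption).
Qed.

(* Antitonicity in [n] is what makes this normal form closed under disjunction. *)
Definition mono_Pi02 (P : nat -> nat -> Prop) : Prop :=
  exists r, computable4 r /\
    (forall x y n n' m, n <= n' -> r x y n' m = 0 -> r x y n m = 0) /\
    forall x y, P x y <-> forall n, exists m, r x y n m = 0.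

Lemma mono_Pi02_Pi02 P : mono_Pi02 P -> Pi02 P.
Proof.
  intros [r [Hr [_ H]]]. exists (fun x y n m => ifz (r x y n m) 1 0). split.
  - apply computable4_of_list; computable_auto.
  - intros x y. rewrite H.
    split; intros G n; destruct (G n) as [m Hm]; exists m.
    + now rewrite Hm.
    + now destruct (r x y n m).
Qed.

Lemma mono_Pi02_decidable f P :
  computable2 f -> (forall x y, P x y <-> f x y = 0) -> mono_Pi02 P.
Proof.
  intros Hf H. exists (fun x y _ _ => f x y). split; [|split].
  - apply computable4_of_list; computable_auto.
  - auto.
  - intros x y; split; [intros G n|intros G].
    + exists 0. now apply H.
    + destruct (G 0). now apply H.
Qed.

(** Excluded middle selects one of two constant functions. Thus [~ E w w'], for fixed entries of the
    finite list, is a single hardwired bit. *)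
Lemma mono_Pi02_const (Q : Prop) : mono_Pi02 (fun _ _ => Q).
Proof.
  destruct (classic Q);
    [apply (mono_Pi02_decidable (fun _ _ => 0))
    |apply (mono_Pi02_decidable (fun _ _ => 1))];
    try (apply computable2_of_list; computable_auto); intuition discriminate.
Qed.

Lemma mono_Pi02_infinitely_often p P :
  computable3 p ->
  (forall x y, P x y <-> infinitely_often (fun s => p x y s = 0)) ->
  mono_Pi02 P.
Proof.
  (* The sum vanishes iff [n <= m] and [p x y m = 0]. *)
  intros Hp H. exists (fun x y n m => (n - m) + p x y m). split; [|split].
  - apply computable4_of_list; computable_auto.
  - intros; lia.
  - intros x y. rewrite H.
    split; intros G n; destruct (G n) as [m Hm]; exists m; lia.
Qed.

Lemma mono_Pi02_and P Q :
  mono_Pi02 P -> mono_Pi02 Q -> mono_Pi02 (fun x y => P x y /\ Q x y).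
Proof.
  intros [p [Cp [Mp Hp]]] [q [Cq [Mq Hq]]].
  exists (fun x y n m => p x y n (cfst m) + q x y n (csnd m)). split; [|split].
  - apply computable4_of_list; computable_auto.
  - intros x y n n' m L H. apply Nat.eq_add_0 in H. apply Nat.eq_add_0.
    split; [eapply Mp | eapply Mq]; (exact L || apply H).
  - intros x y. rewrite Hp, Hq. split.
    + intros [G1 G2] n. destruct (G1 n) as [m1 H1], (G2 n) as [m2 H2].
      exists (cpair m1 m2). rewrite cfst_cpair, csnd_cpair. lia.
    + intros G; split; intros n; destruct (G n) as [m Hm];
        [exists (cfst m) | exists (csnd m)]; lia.
Qed.

Lemma mono_Pi02_or P Q :
  mono_Pi02 P -> mono_Pi02 Q -> mono_Pi02 (fun x y => P x y \/ Q x y).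
Proof.
  intros [p [Cp [Mp Hp]]] [q [Cq [Mq Hq]]].
  exists (fun x y n m => ifz (p x y n m) 0 (q x y n m)). split; [|split].
  - apply computable4_of_list; computable_auto.
  - intros x y n n' m L H. destruct (p x y n' m) eqn:E; simpl in H.
    + now rewrite (Mp _ _ _ _ _ L E).
    + rewrite (Mq _ _ _ _ _ L H). now destruct (p x y n m).
  - intros x y. rewrite Hp, Hq. split.
    + intros [G|G] n; destruct (G n) as [m Hm]; exists m; rewrite Hm;
        [reflexivity | now destruct (p x y n m)].
    + intros G. apply NNPP. intros N. apply not_or_and in N as [N1 N2].
      apply not_all_ex_not in N1 as [n1 N1]. apply not_all_ex_not in N2 as [n2 N2].
      (* By antitonicity, a witness for either disjunct at [n1 + n2] also works at [n1] or [n2]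
         respectively, where that disjunct was assumed to fail. *)
      destruct (G (n1 + n2)) as [m Hm].
      destruct (p x y (n1 + n2) m) eqn:E; simpl in Hm.
      * apply N1. exists m. eapply Mp; [|exact E]. lia.
      * apply N2. exists m. eapply Mq; [|exact Hm]. lia.
Qed.

Lemma mono_Pi02_ext P Q :
  (forall x y, P x y <-> Q x y) -> mono_Pi02 P -> mono_Pi02 Q.
Proof.
  intros H [r [Cr [Mr Hr]]]. exists r. split; [exact Cr|]. split; [exact Mr|].
  intros x y. rewrite <- H. apply Hr.
Qed.

Lemma mono_Pi02_exists_in (l : list nat) (P : nat -> nat -> nat -> Prop) :
  (forall w, mono_Pi02 (P w)) ->
  mono_Pi02 (fun x y => exists w, In w l /\ P w x y).
Proof.
  intros H. induction l as [|w l IH].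
  - apply (mono_Pi02_ext (fun _ _ => False)); [|apply mono_Pi02_const].
    intros x y; split; [tauto | intros [w [[] _]]].
  - eapply mono_Pi02_ext; [|exact (mono_Pi02_or _ _ (H w) IH)].
    intros x y; simpl; split.
    + intros [G|[v [G1 G2]]]; eauto.
    + intros [v [[<-|G1] G2]]; eauto.
Qed.

(** * The diagonal relation *)

(* [out0] to [out3] are the stage-[t] values of the four programs coded by [e] on
   the four points [<e,0>, .., <e,3>]. Before a program halts the value is junk,
   which is harmless because only its behaviour for large [t] is used. *)

Definition points (e : nat) : nat :=
  encl [cpair e 0; cpair e 1; cpair e 2; cpair e 3].

Definition out0 (e t : nat) : nat := run (cfst e) (points e) t.
Definition out1 (e t : nat) : nat := run (cfst (csnd e)) (points e) t.
Definition out2 (e t : nat) : nat := run (cfst (csnd (csnd e))) (points e) t.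
Definition out3 (e t : nat) : nat := run (csnd (csnd (csnd e))) (points e) t.

Lemma computable_points : computable1 points.
Proof. unfold points, encl; simpl. apply computable1_of_list; computable_auto. Qed.
#[local] Hint Resolve computable_points : computable.

Lemma computable_out0 : computable2 out0.
Proof. computable_unfold out0. Qed.
Lemma computable_out1 : computable2 out1.
Proof. computable_unfold out1. Qed.
Lemma computable_out2 : computable2 out2.
Proof. computable_unfold out2. Qed.
Lemma computable_out3 : computable2 out3.
Proof. computable_unfold out3. Qed.
#[local] Hint Resolve computable_out0 computable_out1 computable_out2
  computable_out3 : computable.

Definition dist (a b : nat) : nat := (a - b) + (b - a).

Lemma computable_dist : computable2 dist.
Proof. computable_unfold dist. Qed.
#[local] Hint Resolve computable_dist : computable.

Section Diagonal.

Variables (E : nat -> nat -> Prop) (h : nat -> nat -> nat -> nat) (l : list nat).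

Definition left_flips (e : nat) : Prop :=
  infinitely_often (fun s => h (out0 e s) (out1 e s) s <> 1).

Definition right_flips (e : nat) : Prop :=
  infinitely_often (fun s => h (out2 e s) (out3 e s) s <> 1).

(** The conditions [E y0 w] and [E y2 w'] are expressed through [h] on stage values, since the
    outputs are known only in the limit; this keeps them in Pi02 form. *)
Definition split_in (e : nat) : Prop :=
  exists w, In w l /\ exists w', In w' l /\ ~ E w w' /\
    infinitely_often (fun s => h (out0 e s) w s = 1) /\
    infinitely_often (fun s => h (out2 e s) w' s = 1).

(** To cover all of [nat], each [e] has a left block of points with second coordinate 0 or 1 and a
    right block of all others. The last clause joins both blocks into one class. *)
Definition diagonal (x y : nat) : Prop :=
  x = y \/
  cfst x = cfst y /\
  (csnd x < 2 /\ csnd y < 2 /\ left_flips (cfst x) \/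
   2 <= csnd x /\ 2 <= csnd y /\ right_flips (cfst x) \/
   left_flips (cfst x) /\ right_flips (cfst x) /\ split_in (cfst x)).

Lemma diagonal_equivalence : is_equivalence diagonal.
Proof.
  unfold diagonal. repeat split.
  - auto.
  - intros x y [->|[H1 H2]]; [auto|]. rewrite H1 in *. right. tauto.
  - intros x y z [->|[H1 H2]]; [auto|]. intros [<-|[H3 H4]]; [auto|].
    right. rewrite H1 in *. rewrite H3 in *. split; [reflexivity|].
    (* A left clause followed by a right one would put [y] in both blocks; a joining clause on
       either side already relates [x] to [z]. *)
    destruct H2 as [H2|[H2|H2]], H4 as [H4|[H4|H4]]; tauto || lia.
Qed.

Hypothesis computable_h : computable3 h.
#[local] Hint Resolve computable_h : computable.

Lemma mono_Pi02_left_flips : mono_Pi02 (fun x _ => left_flips (cfst x)).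
Proof.
  apply (mono_Pi02_infinitely_often (fun x _ s =>
    ifz (dist (h (out0 (cfst x) s) (out1 (cfst x) s) s) 1) 1 0)).
  - apply computable3_of_list; computable_auto.
  - intros x _. apply (infinitely_often_eventually _ _ 0). intros t _.
    set (v := h _ _ _). unfold dist.
    destruct (v - 1 + (1 - v)) eqn:D; simpl; lia.
Qed.

Lemma mono_Pi02_right_flips : mono_Pi02 (fun x _ => right_flips (cfst x)).
Proof.
  apply (mono_Pi02_infinitely_often (fun x _ s =>
    ifz (dist (h (out2 (cfst x) s) (out3 (cfst x) s) s) 1) 1 0)).
  - apply computable3_of_list; computable_auto.
  - intros x _. apply (infinitely_often_eventually _ _ 0). intros t _.
    set (v := h _ _ _). unfold dist.
    destruct (v - 1 + (1 - v)) eqn:D; simpl; lia.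
Qed.

Lemma mono_Pi02_split_in : mono_Pi02 (fun x _ => split_in (cfst x)).
Proof.
  unfold split_in.
  apply mono_Pi02_exists_in; intros w. apply mono_Pi02_exists_in; intros w'.
  apply mono_Pi02_and; [apply mono_Pi02_const|]. apply mono_Pi02_and.
  - apply (mono_Pi02_infinitely_often (fun x _ s =>
      dist (h (out0 (cfst x) s) w s) 1)).
    + apply computable3_of_list; computable_auto.
    + intros x _. apply (infinitely_often_eventually _ _ 0). intros t _.
      unfold dist. lia.
  - apply (mono_Pi02_infinitely_often (fun x _ s =>
      dist (h (out2 (cfst x) s) w' s) 1)).
    + apply computable3_of_list; computable_auto.
    + intros x _. apply (infinitely_often_eventually _ _ 0). intros t _.
      unfold dist. lia.
Qed.

Lemma diagonal_Pi02 : Pi02 diagonal.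
Proof.
  apply mono_Pi02_Pi02. unfold diagonal.
  apply mono_Pi02_or.
  { apply (mono_Pi02_decidable dist); [auto with computable|].
    intros x y; unfold dist; lia. }
  apply mono_Pi02_and.
  { apply (mono_Pi02_decidable (fun x y => dist (cfst x) (cfst y)));
      [apply computable2_of_list; computable_auto|].
    intros x y; unfold dist; lia. }
  apply mono_Pi02_or; [|apply mono_Pi02_or];
    repeat apply mono_Pi02_and;
    auto using mono_Pi02_left_flips, mono_Pi02_right_flips, mono_Pi02_split_in.
  - apply (mono_Pi02_decidable (fun x y => S (csnd x) - 2));
      [apply computable2_of_list; computable_auto | intros; lia].
  - apply (mono_Pi02_decidable (fun x y => S (csnd y) - 2));
      [apply computable2_of_list; computable_auto | intros; lia].
  - apply (mono_Pi02_decidable (fun x y => 2 - csnd x));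
      [apply computable2_of_list; computable_auto | intros; lia].
  - apply (mono_Pi02_decidable (fun x y => 2 - csnd y));
      [apply computable2_of_list; computable_auto | intros; lia].
Qed.

End Diagonal.

(* "Infinitely many classes not Delta^0_2": for every finite list of points there
   is a non-Delta^0_2 class avoiding all their classes. *)
Theorem theorem4p13 (E : nat -> nat -> Prop) (h : nat -> nat -> nat -> nat) :
  is_equivalence E -> complete4_Pi02 E -> Pi02_approx E h ->
  forall l : list nat, exists z,
    ~ class_Delta02 E h z /\ (forall w, In w l -> ~ E z w).
Proof.
  intros [Erefl [Esym Etrans]] [_ Hcomp] [Ch HE] l.
  destruct (Hcomp _ (diagonal_equivalence E h l) (diagonal_Pi02 E h l Ch))
    as (g0 & g1 & g2 & g3 & [c0 H0] & [c1 H1] & [c2 H2] & [c3 H3] & Hred).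
  (* The index of the assumed reduction itself, nested as [out0] to [out3] decode it. *)
  set (e := cpair (enc c0) (cpair (enc c1) (cpair (enc c2) (enc c3)))).
  specialize (Hred (cpair e 0) (cpair e 1) (cpair e 2) (cpair e 3)).
  specialize (H0 (cpair e 0) (cpair e 1) (cpair e 2) (cpair e 3)).
  specialize (H1 (cpair e 0) (cpair e 1) (cpair e 2) (cpair e 3)).
  specialize (H2 (cpair e 0) (cpair e 1) (cpair e 2) (cpair e 3)).
  specialize (H3 (cpair e 0) (cpair e 1) (cpair e 2) (cpair e 3)).
  pose proof (Hred 0 1 ltac:(lia) ltac:(lia)) as R01.
  pose proof (Hred 2 3 ltac:(lia) ltac:(lia)) as R23.
  pose proof (Hred 0 2 ltac:(lia) ltac:(lia)) as R02.
  clear Hred. cbn [sel4 tuple4] in R01, R23, R02.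
  set (y0 := g0 _ _ _ _) in *. set (y1 := g1 _ _ _ _) in *.
  set (y2 := g2 _ _ _ _) in *. set (y3 := g3 _ _ _ _) in *.
  apply run_eval in H0 as [T0 H0], H1 as [T1 H1], H2 as [T2 H2], H3 as [T3 H3].
  assert (O0 : forall t, T0 <= t -> out0 e t = y0).
  { intros t Ht. unfold out0, e. rewrite cfst_cpair. now apply H0. }
  assert (O1 : forall t, T1 <= t -> out1 e t = y1).
  { intros t Ht. unfold out1, e. rewrite csnd_cpair, cfst_cpair. now apply H1. }
  assert (O2 : forall t, T2 <= t -> out2 e t = y2).
  { intros t Ht. unfold out2, e. rewrite !csnd_cpair, cfst_cpair. now apply H2. }
  assert (O3 : forall t, T3 <= t -> out3 e t = y3).
  { intros t Ht. unfold out3, e. rewrite !csnd_cpair. now apply H3. }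
  assert (HA : left_flips h e <-> infinitely_often (fun s => h y0 y1 s <> 1)).
  { apply (infinitely_often_eventually _ _ (T0 + T1)). intros t Ht.
    rewrite O0, O1 by lia. tauto. }
  assert (HB : right_flips h e <-> infinitely_often (fun s => h y2 y3 s <> 1)).
  { apply (infinitely_often_eventually _ _ (T2 + T3)). intros t Ht.
    rewrite O2, O3 by lia. tauto. }
  assert (HC : split_in E h l e <->
    exists w, In w l /\ exists w', In w' l /\ ~ E w w' /\ E y0 w /\ E y2 w').
  { assert (G0 : forall w, infinitely_often (fun s => h (out0 e s) w s = 1) <-> E y0 w).
    { intros w. rewrite HE. apply (infinitely_often_eventually _ _ T0).
      intros t Ht. rewrite O0 by lia. tauto. }
    assert (G2 : forall w, infinitely_often (fun s => h (out2 e s) w s = 1) <-> E y2 w).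
    { intros w. rewrite HE. apply (infinitely_often_eventually _ _ T2).
      intros t Ht. rewrite O2 by lia. tauto. }
    unfold split_in. split; intros (w & Hw & w' & Hw' & N & A & B);
      exists w; (split; [exact Hw|]); exists w'; (split; [exact Hw'|]);
      (split; [exact N|]); split; (apply G0 || apply G2); assumption. }
  assert (Hdist : forall i j, cpair e i = cpair e j -> i = j).
  { intros i j Q. apply (f_equal csnd) in Q. now rewrite !csnd_cpair in Q. }
  unfold diagonal in R01, R23, R02.
  rewrite !cfst_cpair, !csnd_cpair in R01, R23, R02.
  assert (Hflip : forall y y', (infinitely_often (fun s => h y y' s <> 1) <-> E y y') ->
    E y y' /\ ~ class_Delta02 E h y).
  { intros y y' Hy.
    assert (Eyy : E y y').
    (* If flips stopped after stage [n], then [h y y'] would be constantly 1 from there on, giving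
       [E y y']; so inequivalence would force infinitely many flips, and these again give
       [E y y']. *)
    { apply NNPP. intros N. apply N, Hy. intros n. apply NNPP. intros M.
      apply N, HE. intros s. exists (n + s). split; [lia|].
      apply NNPP. intros K. apply M. exists (n + s). split; [lia|exact K]. }
    split; [exact Eyy|]. intros D.
    destruct (D y y' (Erefl _) (Esym _ _ Eyy)) as [s0 Hs0].
    destruct (proj2 Hy Eyy s0) as [s [L N]]. apply N, Hs0, L. }
  assert (F01 : E y0 y1 /\ ~ class_Delta02 E h y0).
  (* The points are distinct and both in the left block, so each clause that can relate them
     contains [left_flips]. *)
  { apply Hflip. rewrite <- HA, <- R01. split.
    - intros A. right. split; [reflexivity|]. left. repeat split; [lia|lia|exact A].
    - intros [Q|[_ Q]]; [apply Hdist in Q; discriminate|].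
      destruct Q as [Q|[Q|Q]]; [apply Q | lia | apply Q]. }
  assert (F23 : E y2 y3 /\ ~ class_Delta02 E h y2).
  { apply Hflip. rewrite <- HB, <- R23. split.
    - intros B. right. split; [reflexivity|]. right; left.
      repeat split; [lia|lia|exact B].
    - intros [Q|[_ Q]]; [apply Hdist in Q; discriminate|].
      destruct Q as [Q|[Q|Q]]; [lia | apply Q | apply Q]. }
  apply NNPP. intros Hno.
  assert (Hcover : forall z, ~ class_Delta02 E h z -> exists w, In w l /\ E z w).
  { intros z Hz. apply NNPP. intros N. apply Hno. exists z. split; [exact Hz|].
    intros w Hw Ezw. apply N. eauto. }
  destruct F01 as [E01 N0], F23 as [E23 N2].
  destruct (Hcover _ N0) as [w [Hw E0w]], (Hcover _ N2) as [w' [Hw' E2w]].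
  assert (A : left_flips h e).
  { apply R01 in E01 as [Q|[_ [Q|[Q|Q]]]];
      [apply Hdist in Q; discriminate | apply Q | lia | apply Q]. }
  assert (B : right_flips h e).
  { apply R23 in E23 as [Q|[_ [Q|[Q|Q]]]];
      [apply Hdist in Q; discriminate | lia | apply Q | apply Q]. }
  destruct (classic (E y0 y2)) as [E02|N02].
  (* Only the joining clause can relate points of different blocks, and it supplies inequivalent
     [v], [v'] with [E y0 v] and [E y2 v'], contradicting [E y0 y2]. *)
  - destruct (proj2 R02 E02) as [Q|[_ [Q|[Q|Q]]]];
      [apply Hdist in Q; discriminate | lia | lia |].
    destruct Q as [_ [_ Q]]. apply HC in Q as (v & _ & v' & _ & N & Q0 & Q2).
    apply N. eauto.
  (* Now [w] and [w'] are inequivalent because [y0] and [y2] are, so they witness [split_in] and the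
     blocks are joined. *)
  - apply N02, R02. right. split; [reflexivity|]. right; right.
    split; [exact A|]. split; [exact B|]. apply HC.
    exists w. split; [exact Hw|]. exists w'. split; [exact Hw'|].
    split; [|auto]. intros Eww. apply N02. eauto.
Qed.
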